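(* Let $m\le n$ be positive integers, let $C\in\mathbb{R}^{m\times n}$ have full row rank, let $N$ be a positive integer and $\mathcal{N}:=\{1,2,\ldots,N\}$. Let $\{\mathcal{S}_i\}_{i=1}^N$ be a simplicial conic partition of a set $\mathcal{Z}\subseteq\mathbb{R}^m$ such that, for any two cones $\mathcal{S}_i,\mathcal{S}_j$ of the partition, the intersection $\mathcal{S}_i\cap\mathcal{S}_j$ is a face of both $\mathcal{S}_i$ and $\mathcal{S}_j$. Let $P_1,\ldots,P_N\in\mathbb{R}^{n\times n}$ be symmetric matrices. Let $R_i$, $E_i$, $Z_{ij}$, $H_{ij}$ and $C_\perp$ be the matrices associated with the partition and with $C$ as defined in the context, and let $V$ be any real matrix with $n$ columns satisfying $\operatorname{im} V^\top\supseteq\ker C$. Then the following statements are equivalent: (1) For all $i,j\in\mathcal{N}$, $$x^\top(P_i-P_j)x=0\quad\text{for all }x\in\mathbb{R}^n\text{ with }Cx\in\mathcal{S}_i\cap\mathcal{S}_j,$$ and thus the function on $\{x\in\mathbb{R}^n\mid Cx\in\mathcal{Z}\}$ given by $x\mapsto x^\top P_i x$ when $Cx\in\mathcal{S}_i$ is (well defined and) continuous. (2) For all $i,j\in\mathcal{N}$, $$x^\top(P_i-P_j)x=0\quad\text{for all }x\in\mathbb{R}^n\text{ with }Cx\in\operatorname{im} Z_{ij}.$$ (3) For all $i,j\in\mathcal{N}$, $$W_{ij}^\top(P_i-P_j)W_{ij}=0,\quad\text{where } W_{ij}=T^{-1}\begin{bmatrix} Z_{ij} & 0 \\ 0 & I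 \end{bmatrix},\quad T:=\begin{bmatrix} C \\ C_\perp^\top \end{bmatrix}.$$ (4) There exists a symmetric matrix $\Phi$ (the same for all $i$) such that, for all $i\in\mathcal{N}$, $$P_i=F_i^\top\Phi F_i,\quad\text{where } F_i=\begin{bmatrix} E_iR_i^{-1}C \\ V \end{bmatrix}.$$ (5) There exist real matrices $\Gamma_{ij}$, $i,j\in\mathcal{N}$, such that, for all $i,j\in\mathcal{N}$, $$P_i-P_j+(H_{ij}C)^\top\Gamma_{ij}+\Gamma_{ij}^\top(H_{ij}C)=0.$$
   Context: Cones. A polyhedral cone in $\mathbb{R}^m$ is the positive hull $\{\sum_k\lambda_kz_k\mid\lambda_k\ge0\}$ of a finite set of vectors. A face of a polyhedral cone $\mathcal{C}$ is any set of the form $\mathcal{C}\cap\{z\in\mathbb{R}^m\mid c^\top z=c_0\}$ with $c\in\mathbb{R}^m$, $c_0\in\mathbb{R}$ such that $c^\top z\le c_0$ for all $z\in\mathcal{C}$ (faces may have any dimension, e.g. $\{0\}$ or $\mathcal{C}$ itself). A simplicial cone in $\mathbb{R}^m$ is the positive hull of $m$ linearly independent vectors; these vectors are its extremal rays, unique up to positive multiples. Partitions. A simplicial conic partition of $\mathcal{Z}\subseteq\mathbb{R}^m$ is a family $\{\mathcal{S}_i\}_{i=1}^N$ of simplicial cones with $\mathcal{Z}=\bigcup_{i=1}^N\mathcal{S}_i$, $\operatorname{int}(\mathcal{S}_i)\neq\emptyset$ for all $i$, and $\operatorname{int}(\mathcal{S}_i)\cap\operatorname{int}(\mathcal{S}_j)=\emptyset$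 for $i\ne j$. Matrices $\bar R$, $E_i$, $R_i$. Let $r$ be the number of distinct extremal rays of the partition (rays that are positive multiples of each other are identified, and one representative vector is fixed for each), and let $\bar R=[\,r_1\ r_2\ \cdots\ r_r\,]\in\mathbb{R}^{m\times r}$ be the matrix of these representatives. For each $i$, the extraction matrix $E_i\in\mathbb{R}^{r\times m}$ has its $j$-th row equal to zero for every $j$ with $r_j\notin\mathcal{S}_i$, and its remaining $m$ rows are the rows of the $m\times m$ identity matrix. The extremal ray matrix of $\mathcal{S}_i$ is $R_i=\bar RE_i\in\mathbb{R}^{m\times m}$; it is nonsingular and $\mathcal{S}_i=\{R_i\lambda\mid\lambda\in\mathbb{R}^m_{\ge0}\}$. Matrices $Z_{ij}$, $H_{ij}$. $Z_{ij}$ is a matrix whose columns are exactly the extremal rays (among $r_1,\ldots,r_r$) shared by $\mathcal{S}_i$ and $\mathcal{S}_j$. Under the face assumption these are the extremal rays of $\mathcal{S}_i\cap\mathcal{S}_j$, so $\mathcal{S}_i\cap\mathcal{S}_j=\{Z_{ij}v\mid v\ge0\}$. For a matrix $A$, $A_\perp$ denotes any matrix whose columns form a basis of $\ker A$. $H_{ij}:=((Z_{ij}^\top)_\perp)^\top$, so $H_{ij}$ has full row rank and $\ker H_{ij}=\operatorname{im}Z_{ij}$. Empty-matrix conventions: if there are no shared rays, $Z_{ij}$ has no columns and $\operatorname{im}Z_{ij}=\{0\}$; if $\operatorname{im}Z_{ij}=\mathbb{R}^m$, $H_{ij}$ has no rows; if $m=n$, $C_\perp$ is omitted (so $T=C$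 and $W_{ij}=C^{-1}Z_{ij}$) and $V$ may be omitted (zero rows). The matrices $\Phi$ and $\Gamma_{ij}$ have the sizes that make the expressions meaningful. *)

(* Defs.v *)
From HB Require Import structures.
From mathcomp Require Import all_boot all_order all_algebra.
From mathcomp Require Import all_classical all_reals all_analysis.

Set Implicit Arguments.
Unset Strict Implicit.
Unset Printing Implicit Defensive.

Import Order.TTheory GRing.Theory Num.Theory.
Import numFieldNormedType.Exports.

Local Open Scope classical_set_scope.
Local Open Scope ring_scope.

Definition mx_ker (R : realType) (p q : nat) (A : 'M[R]_(p, q)) :
  set 'cV[R]_q := [set x | A *m x = 0].

Definition mx_im (R : realType) (p q : nat) (A : 'M[R]_(p, q)) :
  set 'cV[R]_p := range (fun y : 'cV[R]_q => A *m y).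

Definition qform (R : realType) (n : nat) (P : 'M[R]_n) (x : 'cV[R]_n) : R :=
  (x^T *m P *m x) 0 0.

Definition pos_hull (R : realType) (m k : nat) (X : k.-tuple 'cV[R]_m) :
    set 'cV[R]_m :=
  [set z | exists2 l : 'I_k -> R,
     forall i, 0 <= l i & z = \sum_(i < k) l i *: tnth X i].

Definition generates_simplicial (R : realType) (m : nat)
    (S : set 'cV[R]_m) (X : m.-tuple 'cV[R]_m) : Prop :=
  free X /\ S = pos_hull X.

Definition simplicial_cone (R : realType) (m : nat) (S : set 'cV[R]_m) : Prop :=
  exists X : m.-tuple 'cV[R]_m, generates_simplicial S X.

Definition extremal_ray (R : realType) (m : nat) (S : set 'cV[R]_m)
    (v : 'cV[R]_m) : Prop :=
  exists2 X : m.-tuple 'cV[R]_m, generates_simplicial S X & v \in X.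

Definition is_face (R : realType) (m : nat) (F S : set 'cV[R]_m) : Prop :=
  exists (c : 'cV[R]_m) (c0 : R),
    (forall z, S z -> (c^T *m z) 0 0 <= c0) /\
    F = S `&` [set z | (c^T *m z) 0 0 = c0].

Definition simplicial_conic_partition (R : realType) (m N : nat)
    (Z : set 'cV[R]_m) (S : 'I_N -> set 'cV[R]_m) : Prop :=
  [/\ forall i, simplicial_cone (S i),
      Z = \bigcup_i S i,
      forall i, (S i)° !=set0
    & forall i j, i != j -> (S i)° `&` (S j)° = set0].

Definition same_ray (R : realType) (m : nat) (u v : 'cV[R]_m) : Prop :=
  exists2 a : R, 0 < a & u = a *: v.

(* The columns of Rbar are representatives of the extremal rays of the family,
   exactly one for each class of rays modulo positive multiples. *)
Definition is_ray_matrix (R : realType) (m N r : nat)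
    (S : 'I_N -> set 'cV[R]_m) (Rbar : 'M[R]_(m, r)) : Prop :=
  [/\ forall j, exists i, extremal_ray (S i) (col j Rbar),
      forall i v, extremal_ray (S i) v -> exists j, same_ray v (col j Rbar)
    & forall j k, same_ray (col j Rbar) (col k Rbar) -> j = k].

(* The nonzero rows of E are the rows of the identity, each used once but in
   any order: f k is the position of the k-th row of the identity. *)
Definition is_extraction_matrix (R : realType) (m r : nat)
    (S : set 'cV[R]_m) (Rbar : 'M[R]_(m, r)) (E : 'M[R]_(r, m)) : Prop :=
  (forall j, ~ S (col j Rbar) -> row j E = 0) /\
  exists f : 'I_m -> 'I_r,
    [/\ injective f,
        range f = [set j | S (col j Rbar)]
      & forall k, row (f k) E = row k 1%:M].

(* The columns of Z are the columns of Rbar that are extremal rays of both S1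
   and S2, each occurring once and in any order. *)
Definition is_shared_ray_matrix (R : realType) (m r q : nat)
    (S1 S2 : set 'cV[R]_m) (Rbar : 'M[R]_(m, r)) (Z : 'M[R]_(m, q)) : Prop :=
  exists f : 'I_q -> 'I_r,
    [/\ injective f,
        range f = [set j | extremal_ray S1 (col j Rbar) /\
                           extremal_ray S2 (col j Rbar)]
      & Z = colsub f Rbar].

(* The columns of B are a basis of the kernel of A. *)
Definition is_perp (R : realType) (p q s : nat)
    (A : 'M[R]_(p, q)) (B : 'M[R]_(q, s)) : Prop :=
  row_free B^T /\ mx_im B = mx_ker A.

(* The casts identify m + (n - m) with n, so that T is square. *)
Definition T_mx (R : realType) (m n : nat) (le_mn : (m <= n)%N)
    (C : 'M[R]_(m, n)) (Cperp : 'M[R]_(n, n - m)) : 'M[R]_n :=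
  castmx (subnKC le_mn, erefl n) (col_mx C Cperp^T).

Definition W_mx (R : realType) (m n q : nat) (le_mn : (m <= n)%N)
    (C : 'M[R]_(m, n)) (Cperp : 'M[R]_(n, n - m)) (Z : 'M[R]_(m, q)) :
    'M[R]_(n, q + (n - m)) :=
  invmx (T_mx le_mn C Cperp) *m
  castmx (subnKC le_mn, erefl (q + (n - m))%N)
    (block_mx Z 0 0 (1%:M : 'M[R]_(n - m))).

Definition F_mx (R : realType) (m n r v : nat) (C : 'M[R]_(m, n))
    (Rbar : 'M[R]_(m, r)) (E : 'M[R]_(r, m)) (V : 'M[R]_(v, n)) :
    'M[R]_(r + v, n) :=
  col_mx (E *m invmx (Rbar *m E) *m C) V.

(* Main.v *)
(** The cone [S i] is [{z | R_i^-1 z >= 0}] with [R_i = Rbar E_i], and the face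
    assumption makes [S i `&` S j] the cone spanned by the columns of [Z i j].
    A quadratic form vanishing on a convex cone vanishes on its span by
    polarization, so (1) and (2) say the same thing; (3) is (2) in the
    coordinates given by [T], and (5) is (2) for the kernel of [H i j *m C].
    The map [F_i] sends [x] to the coordinates of [C x] along all rays and [V x],
    so [F_i] and [F_j] agree where [C x] is in [im (Z i j)], and (4) implies (2).
    Conversely all the [F_i] have a common left inverse [L]; by (2) the entries
    of [L^T P_i L] at indices active in both [i] and [j] do not depend on the
    cone, so they glue to one matrix [Phi]. *)
Require Import Defs.
From HB Require Import structures.
From mathcomp Require Import all_boot all_order all_algebra.
From mathcomp Require Import all_classical all_reals all_analysis.

Set Implicit Arguments.
Unset Strict Implicit.
Unset Printing Implicit Defensive.

Import Order.TTheory GRing.Theory Num.Theory.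
Import numFieldNormedType.Exports.

Local Open Scope classical_set_scope.
Local Open Scope ring_scope.

(** * Kernels, Gram matrices and column selections *)

Lemma unitmx_ker (F : fieldType) n (A : 'M[F]_n) :
  (forall y : 'cV_n, A *m y = 0 -> y = 0) -> A \in unitmx.
Proof.
move=> A0; rewrite -unitmx_tr -row_free_unit; apply: inj_row_free => w wA.
apply: trmx_inj; rewrite trmx0; apply: A0.
by rewrite -[A]trmxK -trmx_mul wA trmx0.
Qed.

Lemma dotmx_eq0 (F : realDomainType) p (x : 'cV[F]_p) : x^T *m x = 0 -> x = 0.
Proof.
move=> /matrixP /(_ 0 0); rewrite !mxE => xx; apply/colP => i; rewrite mxE.
have x_ge0 j : true -> 0 <= x^T 0 j * x j 0 by rewrite mxE -expr2 sqr_ge0.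
by have /eqP := psumr_eq0P x_ge0 xx (i := i) isT; rewrite mxE mulf_eq0 orbb => /eqP.
Qed.

Lemma row_free_mul0 (F : fieldType) p q (A : 'M[F]_(p, q)) (z : 'cV_p) :
  row_free A -> A^T *m z = 0 -> z = 0.
Proof.
move=> fA Az; apply: trmx_inj; apply: (row_free_inj fA).
by rewrite /= trmx0 mul0mx -[A]trmxK -trmx_mul Az trmx0.
Qed.

Lemma gram_unitmx (F : realFieldType) p q (A : 'M[F]_(p, q)) :
  row_free A -> A *m A^T \in unitmx.
Proof.
move=> fA; apply: unitmx_ker => z Az; apply: (row_free_mul0 fA).
by apply: dotmx_eq0; rewrite trmx_mul trmxK -mulmxA [A *m _]mulmxA Az mulmx0.
Qed.

(** Columns of [M] outside the range of [g] meet only zero rows of [A]; injectivity counts each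
    remaining index once. *)
Lemma mulmx_colsub_supp (K : pzRingType) m r q p (g : 'I_q -> 'I_r)
    (M : 'M[K]_(m, r)) (A : 'M[K]_(r, p)) :
  injective g -> (forall j, ~ range g j -> row j A = 0) ->
  M *m A = colsub g M *m rowsub g A.
Proof.
move=> g_inj A0; apply/matrixP => a b; rewrite !mxE.
rewrite (bigID (mem (g @: [set: 'I_q]%SET))) /= [X in _ + X]big1 ?addr0.
  rewrite big_imset /=; last by move=> ? ? _ _ /g_inj.
  by apply: eq_big => [k|k _]; rewrite ?inE // !mxE.
move=> j jg; have /rowP/(_ b) : row j A = 0.
  by apply: A0 => -[k _ kj]; case/imsetP: jg; exists k; rewrite ?inE.
by rewrite !mxE => ->; rewrite mulr0.
Qed.

Lemma mulmx_col (K : pzRingType) m p q (A : 'M[K]_(m, p)) (B : 'M[K]_(p, q)) j :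
  A *m col j B = col j (A *m B).
Proof. by rewrite !colE mulmxA. Qed.

Lemma col_colsub (K : Type) m p q (g : 'I_q -> 'I_p) (A : 'M[K]_(m, p)) k :
  col k (colsub g A) = col (g k) A.
Proof. by apply/colP => a; rewrite !mxE. Qed.

Lemma mx_im_sub (R : realType) p q s (A : 'M[R]_(p, q)) (B : 'M[R]_(p, s)) :
  (forall j, mx_im A (col j B)) -> exists M, B = A *m M.
Proof.
move=> AB; suff /submxP[M BM] : (B^T <= A^T)%MS.
  by exists M^T; apply: trmx_inj; rewrite trmx_mul trmxK.
apply/row_subP => j; rewrite -tr_col; have [y _ <-] := AB j.
by rewrite trmx_mul submxMl.
Qed.

(** * Quadratic forms and polarization *)

Lemma qform_mul (R : realType) n p (D : 'M[R]_n) (W : 'M[R]_(n, p)) y :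
  qform D (W *m y) = qform (W^T *m D *m W) y.
Proof. by rewrite /qform trmx_mul !mulmxA. Qed.

Lemma qformB (R : realType) n (A B : 'M[R]_n) x :
  qform (A - B) x = qform A x - qform B x.
Proof. by rewrite /qform mulmxBr mulmxBl !mxE. Qed.

Lemma qform0 (R : realType) n (x : 'cV[R]_n) : qform 0 x = 0.
Proof. by rewrite /qform mulmx0 mul0mx mxE. Qed.

Lemma qformD (R : realType) n (D : 'M[R]_n) (x y : 'cV[R]_n) : D^T = D ->
  qform D (x + y) = qform D x + qform D y + (x^T *m D *m y) 0 0 *+ 2.
Proof.
move=> Dsym; have yx : (y^T *m D *m x) 0 0 = (x^T *m D *m y) 0 0.
  by rewrite -[y^T *m D *m x]trmxK [LHS]mxE !trmx_mul trmxK Dsym mulmxA.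
rewrite /qform [(x + y)^T]linearD !mulmxDl !mulmxDr.
have addE (A B : 'M[R]_1) : (A + B) 0 0 = A 0 0 + B 0 0 by rewrite mxE.
rewrite !addE yx.
by rewrite mulr2n [X in _ + X]addrC addrACA.
Qed.

Lemma qform_polar0 (R : realType) n (D : 'M[R]_n) (x y : 'cV[R]_n) :
  D^T = D -> qform D x = 0 -> qform D y = 0 -> qform D (x + y) = 0 ->
  x^T *m D *m y = 0.
Proof.
move=> Dsym x0 y0; rewrite qformD // x0 y0 !add0r => /eqP.
by rewrite mulrn_eq0 /= => /eqP xy; apply/matrixP => a b; rewrite !ord1 xy mxE.
Qed.

Lemma congr_mxE (K : pzRingType) n p (D : 'M[K]_n) (W : 'M[K]_(n, p)) a b :
  (W^T *m D *m W) a b = ((col a W)^T *m D *m col b W) 0 0.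
Proof. by rewrite tr_col -!row_mul colE mulmxA -colE !mxE. Qed.

(** Entry [(a, b)] is the bilinear form at columns [a] and [b] of [W]; these and their sum lie in
    the image of [W], so polarization applies. *)
Lemma congr_mx_eq0 (R : realType) n p (D : 'M[R]_n) (W : 'M[R]_(n, p)) :
  D^T = D -> (forall y, qform D (W *m y) = 0) -> W^T *m D *m W = 0.
Proof.
move=> Dsym W0; apply/matrixP => a b.
by rewrite congr_mxE !colE (qform_polar0 Dsym) -?mulmxDr ?W0 ?mxE.
Qed.

(** * Simplicial cones in the coordinates of their generators *)

Lemma sum_scale_colE (R : realType) m k (M : 'M[R]_(m, k)) (y : 'I_k -> R) :
  \sum_i y i *: col i M = M *m \col_i y i.
Proof.
apply/colP => a; rewrite summxE mxE; apply: eq_bigr => i _.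
by rewrite !mxE mulrC.
Qed.

Lemma free_unitmx (R : realType) m (X : m.-tuple 'cV[R]_m) (M : 'M[R]_m) :
  (forall k, col k M = tnth X k) -> free X <-> M \in unitmx.
Proof.
move=> XM; have sumE y : \sum_(i < m) y i *: X`_i = M *m \col_i y i.
  by rewrite -sum_scale_colE; apply: eq_bigr => i _; rewrite XM -tnth_nth.
split=> [/freeP fX | uM].
  apply: unitmx_ker => y My; have y0 := fX (fun i => y i 0).
  apply/colP => i; rewrite mxE y0 // sumE -[RHS]My; congr (_ *m _).
  by apply/colP => k; rewrite mxE.
apply/freeP => y; rewrite sumE => My i.
suff /colP/(_ i) : \col_i y i = 0 :> 'cV[R]_m by rewrite !mxE.
by rewrite -[LHS](mulKmx uM) My mulmx0.
Qed.

Lemma pos_hull_unitmx (R : realType) m (X : m.-tuple 'cV[R]_m) (M : 'M[R]_m) z :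
  (forall k, col k M = tnth X k) -> M \in unitmx ->
  pos_hull X z <-> forall k, 0 <= (invmx M *m z) k 0.
Proof.
move=> XM uM; split=> [[l l_ge0 ->] k | z_ge0].
  under eq_bigr do rewrite -XM.
  by rewrite sum_scale_colE mulKmx // mxE.
exists (fun k => (invmx M *m z) k 0) => //.
under eq_bigr do rewrite -XM.
rewrite sum_scale_colE -[LHS](mulKVmx uM); congr (_ *m _).
by apply/colP => k; rewrite [RHS]mxE.
Qed.

(** Rows of [E] outside the range of [f] vanish and the others form an identity, so multiplying by
    [E] selects the rays lying in [S]. *)
Lemma extraction_colsub (R : realType) m r (S : set 'cV[R]_m)
    (Rbar : 'M[R]_(m, r)) E : is_extraction_matrix S Rbar E ->
  exists f : 'I_m -> 'I_r,
    [/\ injective f, range f = [set j | S (col j Rbar)], Rbar *m E = colsub f Rbar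
      & forall k, row (f k) E = row k 1%:M].
Proof.
move=> [E0 [f [f_inj fS Ef]]]; exists f; split=> //.
rewrite (mulmx_colsub_supp _ f_inj) => [|j]; last first.
  by rewrite fS => /E0.
suff -> : rowsub f E = 1%:M by rewrite mulmx1.
apply/row_matrixP => k; rewrite -Ef.
by apply/rowP => a; rewrite !mxE.
Qed.

(** * One cone and its extraction matrix *)

Section ExtractedCone.

Context (R : realType) (m r : nat) (S : set 'cV[R]_m) (Rbar : 'M[R]_(m, r))
  (E : 'M[R]_(r, m)).
Context (S_simpl : simplicial_cone S)
  (S_rays : forall v, extremal_ray S v -> exists j, same_ray v (col j Rbar))
  (E_extr : is_extraction_matrix S Rbar E).

(** Each generator of [S] is a positive multiple of a column of [Rbar *m E], so the generator matrix
    factors as [Rbar *m E *m D] with [D] nonnegative. This gives invertibility and one inclusion of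
    cones; the other holds since the columns of [Rbar *m E] lie in [S]. *)
Lemma extraction_cone : Rbar *m E \in unitmx /\
  forall z, S z <-> forall k, 0 <= (invmx (Rbar *m E) *m z) k 0.
Proof.
have [X [fX SX]] := S_simpl; have [f [f_inj fS RE _]] := extraction_colsub E_extr.
pose XM := \matrix_(a, k) tnth X k a 0.
have XME k : col k XM = tnth X k by apply/colP => a; rewrite !mxE.
have uX : XM \in unitmx by apply/(free_unitmx XME).
have SE z : S z <-> forall k, 0 <= (invmx XM *m z) k 0.
  by rewrite SX; apply: pos_hull_unitmx.
have /choice[s sP] a : exists ks : 'I_m * R, 0 < ks.2 /\
    tnth X a = ks.2 *: col ks.1 (Rbar *m E).
  have [|j [c c_gt0 Xc]] := @S_rays (tnth X a).
    by exists X => //; exact: mem_tnth.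
  (* This column is a generator divided by [c > 0]. *)
  have : S (col j Rbar).
    apply/SE => k; rewrite -[col j Rbar]scale1r -(mulVf (lt0r_neq0 c_gt0)).
    rewrite -scalerA -Xc -XME colE -scalemxAr mulKmx // !mxE.
    by rewrite mulr_ge0 ?invr_ge0 ?(ltW c_gt0) // ler0n.
  move=> Sj; have [k _ fk] : range f j by rewrite fS.
  by exists (k, c); split=> //=; rewrite RE Xc -fk col_colsub.
(* The only nonzero entry of column [a] is the positive factor [(s a).2], in row [(s a).1]. *)
pose D : 'M[R]_m := \matrix_(k, a) ((s a).2 *+ (k == (s a).1)).
have XD : XM = Rbar *m E *m D.
  apply/matrixP => b a; rewrite [RHS]mxE (bigD1 (s a).1) //= big1 => [|k ka].
    by rewrite mxE (sP a).2 !mxE eqxx addr0 mulrC.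
  by rewrite [D _ _]mxE (negbTE ka) mulr0.
have uR : Rbar *m E \in unitmx by move: uX; rewrite XD unitmx_mul => /andP[].
have nneg_mul p q (A : 'M[R]_(p, q)) (y : 'cV_q) : (forall k l, 0 <= A k l) ->
    (forall k, 0 <= y k 0) -> forall k, 0 <= (A *m y : 'cV_p) k 0.
  by move=> A0 y0 k; rewrite mxE sumr_ge0 // => l _; rewrite mulr_ge0.
split=> // z; split=> [/SE z_ge0 k | z_ge0].
  have invD : invmx (Rbar *m E) *m XM = D by rewrite XD mulKmx.
  rewrite -[z](mulKVmx uX) (mulmxA _ XM) invD; apply: nneg_mul => // a b.
  by rewrite mxE mulrn_wge0 // ltW // (sP b).1.
apply/SE => k; rewrite -[z](mulKVmx uR) (mulmxA _ (Rbar *m E)); apply: nneg_mul => // a b.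
have /SE/(_ a) : S (col b (Rbar *m E)).
  have : range f (f b) by exists b.
  by rewrite fS /= RE col_colsub.
by rewrite mulmx_col mxE.
Qed.

Let uR := extraction_cone.1.
Let SE := extraction_cone.2.

Lemma col_extraction j : S (col j Rbar) ->
  exists k, col j Rbar = col k (Rbar *m E).
Proof.
have [f [_ fS RE _]] := extraction_colsub E_extr.
move=> Sj; have [k _ <-] : range f j by rewrite fS.
by exists k; rewrite RE col_colsub.
Qed.

(** A column of [Rbar] lying in [S] is a column of [Rbar *m E], and these columns are themselves a
    generating tuple of [S]. *)
Lemma extremal_rayE j : extremal_ray S (col j Rbar) <-> S (col j Rbar).
Proof.
split=> [[X [fX ->] /tnthP[k ->]] | /col_extraction[k ->]].
  exists (fun l => (l == k)%:R) => [l|]; first exact: ler0n.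
  rewrite (bigD1 k) //= eqxx scale1r big1 ?addr0 // => l /negbTE->.
  by rewrite scale0r.
pose X := [tuple col k (Rbar *m E) | k < m].
have XE k' : col k' (Rbar *m E) = tnth X k' by rewrite tnth_mktuple.
exists X; last by rewrite XE mem_tnth.
split; first exact/(free_unitmx XE).
by apply/seteqP; split=> z /=; rewrite SE pos_hull_unitmx.
Qed.

(** The result does not mention [S]: coordinates are indexed by all rays of the partition, so two
    cones give a shared ray the same coordinates. *)
Lemma extraction_ray_coord j : S (col j Rbar) ->
  E *m invmx (Rbar *m E) *m col j Rbar = delta_mx j 0.
Proof.
have [f [f_inj fS RE fE]] := extraction_colsub E_extr.
have [E0 [_ _]] := E_extr.
move=> Sj; have [k _ fk] : range f j by rewrite fS.
have -> : col j Rbar = col k (Rbar *m E).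
  by rewrite RE -fk col_colsub.
rewrite colE -(mulmxA E) mulKmx // -colE; apply/colP => a; rewrite !mxE andbT.
have [Sa|Sa] := pselect (S (col a Rbar)); last first.
  have /rowP/(_ k) := E0 _ Sa; rewrite !mxE => ->.
  by case: eqP => // aj; rewrite aj in Sa.
have [l _ fl] : range f a by rewrite fS.
have /rowP/(_ k) := fE l; rewrite fl !mxE => ->.
by rewrite -(inj_eq f_inj) fl fk.
Qed.
End ExtractedCone.

(** The supporting functional is nonpositive on every ray and zero at [z], a nonnegative combination
    of rays; hence it vanishes on each ray that occurs in [z]. *)
Lemma face_ray (R : realType) m (S F : set 'cV[R]_m) (M : 'M[R]_m) z k :
  M \in unitmx -> (forall y, S y <-> forall l, 0 <= (invmx M *m y) l 0) ->
  is_face F S -> F z -> (invmx M *m z) k 0 != 0 -> F (col k M).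
Proof.
move=> uM SE [c [c0 [c_le ->]]] [Sz /= cz] zk.
have Scol l : S (col l M).
  by apply/SE => l'; rewrite colE mulKmx // mxE ler0n.
(* A cone contains [z *+ 2], so [c0 *+ 2 <= c0], and it contains 0, so [0 <= c0]. *)
have c00 : c0 = 0.
  apply/eqP; rewrite eq_le; apply/andP; split.
    have : S (z *+ 2).
      move/SE: Sz => Sz; apply/SE => l.
      by rewrite [_ *m _]raddfMn mulmxnE mulrn_wge0.
    move/c_le; rewrite raddfMn mulmxnE cz.
    by rewrite mulr2n gerDl.
  have := c_le 0; rewrite mulmx0 mxE; apply; apply/SE => l.
  by rewrite mulmx0 mxE.
pose y := invmx M *m z.
have cM_le0 l : (c^T *m M) 0 l <= 0.
  by have := c_le _ (Scol l); rewrite c00 mulmx_col mxE.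
have : \sum_l - ((c^T *m M) 0 l * y l 0) = 0.
  rewrite sumrN; apply/eqP; rewrite oppr_eq0; apply/eqP.
  by rewrite -[RHS]c00 -cz -[z](mulKVmx uM) (mulmxA _ M) [RHS]mxE.
move/SE: Sz => Sz.
have t_ge0 l : true -> 0 <= - ((c^T *m M) 0 l * y l 0).
  by rewrite -mulNr mulr_ge0 // oppr_ge0.
move/(psumr_eq0P t_ge0)/(_ k isT)/eqP.
rewrite oppr_eq0 mulf_eq0 (negbTE zk) orbF => /eqP ck.
by split=> //=; rewrite mulmx_col mxE ck c00.
Qed.

(** * Rays shared by two cones *)

Section SharedRays.

Context (R : realType) (m r q : nat) (S1 S2 : set 'cV[R]_m)
  (Rbar : 'M[R]_(m, r)) (E1 E2 : 'M[R]_(r, m)) (Z : 'M[R]_(m, q)).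
Context (S1_simpl : simplicial_cone S1) (S2_simpl : simplicial_cone S2)
  (S1_rays : forall v, extremal_ray S1 v -> exists j, same_ray v (col j Rbar))
  (S2_rays : forall v, extremal_ray S2 v -> exists j, same_ray v (col j Rbar))
  (E1_extr : is_extraction_matrix S1 Rbar E1)
  (E2_extr : is_extraction_matrix S2 Rbar E2)
  (Z_shared : is_shared_ray_matrix S1 S2 Rbar Z).

Lemma shared_rayP : exists g : 'I_q -> 'I_r,
  [/\ injective g, Z = colsub g Rbar &
      range g = [set j | S1 (col j Rbar) /\ S2 (col j Rbar)]].
Proof.
have [g [g_inj gE ZE]] := Z_shared; exists g; split=> //; rewrite gE.
have e1 := extremal_rayE S1_simpl S1_rays E1_extr.
have e2 := extremal_rayE S2_simpl S2_rays E2_extr.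
by apply/seteqP; split=> j /= [/e1 ? /e2 ?].
Qed.

Lemma mx_im_shared j : S1 (col j Rbar) -> S2 (col j Rbar) ->
  mx_im Z (col j Rbar).
Proof.
have [g [_ -> gE]] := shared_rayP => S1j S2j.
have [k _ <-] : range g j by rewrite gE.
exists (delta_mx k 0) => //.
by rewrite -colE col_colsub.
Qed.

Lemma shared_sub_meet (w : 'cV_q) : (forall k, 0 <= w k 0) -> (S1 `&` S2) (Z *m w).
Proof.
move=> w_ge0; have [g [_ -> gE]] := shared_rayP.
have gS k : S1 (col (g k) Rbar) /\ S2 (col (g k) Rbar).
  by have : range g (g k) by [exists k]; rewrite gE.
have coneS M S : (forall z, S z <-> forall k, 0 <= (invmx M *m z) k 0) ->
    (forall k, S (col (g k) Rbar)) -> S (colsub g Rbar *m w).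
  move=> SE gS'; apply/SE => l; rewrite mulmxA mxE sumr_ge0 // => k _.
  rewrite mulr_ge0 //; move/SE/(_ l): (gS' k); rewrite mulmx_col mxE.
  by rewrite mulmx_colsub [X in _ -> 0 <= X]mxE.
have [_ SE1] := extraction_cone S1_simpl S1_rays E1_extr.
have [_ SE2] := extraction_cone S2_simpl S2_rays E2_extr.
by split; [apply: (coneS _ _ SE1) | apply: (coneS _ _ SE2)] => k; have [] := gS k.
Qed.

(** By the face assumption, every ray with a nonzero coefficient in [z] lies in the intersection,
    hence is a column of [Z]. *)
Lemma meet_sub_shared z :
  is_face (S1 `&` S2) S1 -> (S1 `&` S2) z -> mx_im Z z.
Proof.
move=> face12 Sz; have [g [g_inj -> gE]] := shared_rayP.
have [uR SE] := extraction_cone S1_simpl S1_rays E1_extr.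
have [f [f_inj fS RE fE]] := extraction_colsub E1_extr.
pose y := invmx (Rbar *m E1) *m z.
have yE : z = Rbar *m (E1 *m y) by rewrite mulmxA mulKVmx.
rewrite yE (mulmx_colsub_supp _ g_inj); first by exists (rowsub g (E1 *m y)).
(* An unshared ray has coordinate 0: outside [S1] the row of [E1] is zero, inside [S1] a nonzero
   coordinate would contradict [face_ray]. *)
move=> j gj; have [S1j|S1j] := pselect (S1 (col j Rbar)); last first.
  by rewrite row_mul (E1_extr.1 _ S1j) mul0mx.
have [k _ fk] : range f j by rewrite fS.
apply/rowP => o; rewrite ord1 row_mul -fk fE -row_mul mul1mx [LHS]mxE [RHS]mxE.
apply/eqP/negP => /negP yk; apply: gj; rewrite gE /= -fk.
have := face_ray uR SE face12 Sz yk.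
by rewrite RE col_colsub.
Qed.

(** By linearity it suffices to compare columns of [Z], where both sides are the same unit
    vector. *)
Lemma extraction_coord_eq z : mx_im Z z ->
  E1 *m invmx (Rbar *m E1) *m z = E2 *m invmx (Rbar *m E2) *m z.
Proof.
have [g [_ -> gE]] := shared_rayP => -[w _ <-].
rewrite !(mulmxA _ (colsub g Rbar)) !mulmx_colsub; congr (_ *m w).
apply/matrixP => a k; have [S1k S2k] : S1 (col (g k) Rbar) /\ S2 (col (g k) Rbar).
  by have : range g (g k) by [exists k]; rewrite gE.
have := extraction_ray_coord S1_simpl S1_rays E1_extr S1k.
rewrite -(extraction_ray_coord S2_simpl S2_rays E2_extr S2k) !mulmx_col.
by move=> /colP/(_ a); rewrite !mxE.
Qed.

End SharedRays.

(** * The coordinates given by [T], and the image of [W] *)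

Lemma cast_T_unitmx (R : realType) m n d (e : (m + d = n)%N)
    (C : 'M[R]_(m, n)) (Cperp : 'M[R]_(n, d)) :
  is_perp C Cperp -> castmx (e, erefl n) (col_mx C Cperp^T) \in unitmx.
Proof.
(* With [n - m] generalized to [d], eliminating [e] removes the casts. A vector killed by [T] lies
   in [im Cperp] and is orthogonal to it, so it is zero. *)
case: n / e C Cperp => C Cperp [Cp_free Cp_im]; rewrite castmx_id.
apply: unitmx_ker => x; rewrite mul_col_mx -[X in _ = X -> _]col_mx0.
move=> /eq_col_mx[Cx Cpx].
have : mx_im Cperp x by rewrite Cp_im; exact: Cx.
move=> [y _ xy]; rewrite -xy; suff -> : y = 0 by rewrite mulmx0.
apply: (row_free_mul0 Cp_free); rewrite trmxK.
by apply: dotmx_eq0; rewrite trmx_mul -mulmxA xy Cpx mulmx0.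
Qed.

Lemma mx_im_cast_W (R : realType) m n d q (e : (m + d = n)%N)
    (C : 'M[R]_(m, n)) (Cperp : 'M[R]_(n, d)) (Z : 'M[R]_(m, q)) x :
  castmx (e, erefl n) (col_mx C Cperp^T) \in unitmx ->
  mx_im (invmx (castmx (e, erefl n) (col_mx C Cperp^T)) *m
         castmx (e, erefl (q + d)%N) (block_mx Z 0 0 1%:M)) x <->
  mx_im Z (C *m x).
Proof.
case: n / e C Cperp x => C Cperp x; rewrite !castmx_id => uT.
split=> [[y _ <-]|[w _ Zw]].
  set x' := _ *m y; have : col_mx C Cperp^T *m x' = block_mx Z 0 0 1%:M *m y.
    by rewrite /x' -mulmxA mulKVmx.
  rewrite mul_col_mx block_mxEv mul_col_mx => /eq_col_mx[-> _].
  exists (usubmx y) => //.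
  by rewrite -[y in RHS]vsubmxK mul_row_col mul0mx addr0.
(* The lower block of [T *m x] is unconstrained, so it serves as its own coordinates. *)
exists (col_mx w (Cperp^T *m x)) => //.
rewrite -mulmxA mul_block_col !(mul0mx, mul1mx) addr0 add0r Zw -mul_col_mx.
by rewrite mulKmx.
Qed.

Lemma mx_im_W (R : realType) m n q (le_mn : (m <= n)%N) (C : 'M[R]_(m, n))
    Cperp (Z : 'M[R]_(m, q)) x : is_perp C Cperp ->
  mx_im (W_mx le_mn C Cperp Z) x <-> mx_im Z (C *m x).
Proof. by move=> Cp; apply: mx_im_cast_W; apply: cast_T_unitmx. Qed.

(** * The kernel of [H] and the matrices [Gamma] *)

Lemma perp_mulmx (R : realType) m q h (Z : 'M[R]_(m, q)) (H : 'M[R]_(h, m)) :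
  is_perp Z^T H^T -> H *m Z = 0.
Proof.
move=> [_ H_im]; apply: trmx_inj; rewrite trmx_mul trmx0.
apply/trmx_inj/row_matrixP => k; rewrite -tr_col colE -mulmxA -colE.
have : mx_ker Z^T (col k H^T) by rewrite -H_im; exists (delta_mx k 0); rewrite -?colE.
by rewrite /mx_ker /= => ->; rewrite !trmx0 row0.
Qed.

(** The columns of [cokermx Z^T] lie in [ker Z^T = im H^T], so [H *m z = 0] makes the cokernel
    annihilate [z^T]. *)
Lemma perp_ker (R : realType) m q h (Z : 'M[R]_(m, q)) (H : 'M[R]_(h, m)) z :
  is_perp Z^T H^T -> H *m z = 0 -> mx_im Z z.
Proof.
move=> [_ H_im] Hz.
have [M ZM] : exists M, cokermx Z^T = H^T *m M.
  apply: mx_im_sub => j; rewrite H_im /mx_ker /= mulmx_col.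
  by rewrite mulmx_coker col0.
have /submxP[w zw] : (z^T <= Z^T)%MS.
  by rewrite submxE ZM mulmxA -trmx_mul Hz trmx0 mul0mx.
by exists w^T => //; apply: trmx_inj; rewrite trmx_mul trmxK -zw.
Qed.

(* The projection [1 - B A] onto [ker A], for a right inverse [B] of [A],
   annihilates [D] on both sides; expanding that identity gives [Gamma]. *)
Lemma qform_ker_decomp (R : realType) n h (D : 'M[R]_n) (A : 'M[R]_(h, n)) :
  D^T = D -> row_free A -> (forall x, A *m x = 0 -> qform D x = 0) ->
  exists G : 'M[R]_(h, n), D + A^T *m G + G^T *m A = 0.
Proof.
move=> Dsym /row_freeP[B AB] D0.
have : (1%:M - B *m A)^T *m D *m (1%:M - B *m A) = 0.
  apply: congr_mx_eq0 => // y; apply: D0.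
  by rewrite mulmxA mulmxBr mulmx1 mulmxA AB mul1mx subrr mul0mx.
set X := A^T *m B^T *m D; set Y := D *m B *m A.
set W := A^T *m B^T *m D *m B *m A.
have -> : (1%:M - B *m A)^T *m D *m (1%:M - B *m A) = D - X - (Y - W).
  rewrite [(_ - _)^T]linearB /= trmx1 trmx_mul mulmxBl mul1mx mulmxBr mulmx1 mulmxBl.
  by rewrite !mulmxA.
(* The term [W] is split evenly between [A^T *m G] and its transpose, hence the factor one half. *)
move=> XYW; exists (2%:R^-1 *: (B^T *m D *m B *m A) - B^T *m D).
rewrite mulmxBr -scalemxAr [(_ - _)^T]linearB linearZ /= mulmxBl -scalemxAl.
rewrite !trmx_mul Dsym !trmxK !mulmxA -/X -/Y -/W.
have half : 2%:R^-1 *: W + 2%:R^-1 *: W = W.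
  by rewrite -scalerDl -mulr2n -[_^-1 *+ 2]mulr_natl mulfV ?pnatr_eq0 // scale1r.
rewrite -XYW -[in RHS]half opprB -!addrA; congr (_ + _).
by rewrite addrCA !addrA.
Qed.

Lemma qform_decomp_ker (R : realType) n h (D : 'M[R]_n) (A G : 'M[R]_(h, n)) x :
  D + A^T *m G + G^T *m A = 0 -> A *m x = 0 -> qform D x = 0.
Proof.
move=> /(congr1 (fun M => x^T *m (M *m x))) + Ax.
rewrite !mulmxDl -(mulmxA G^T) Ax !mulmx0 addr0 mul0mx mulmx0.
rewrite mulmxDr -(mulmxA A^T) (mulmxA x^T A^T) -trmx_mul Ax trmx0 mul0mx addr0.
by rewrite mulmxA => /matrixP/(_ 0 0); rewrite [RHS]mxE.
Qed.

(** * A common left inverse and the gluing of [Phi] *)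

Lemma right_inverse_ker (R : realType) m n v (C : 'M[R]_(m, n))
    (V : 'M[R]_(v, n)) : row_free C -> mx_ker C `<=` mx_im V^T ->
  exists (B : 'M[R]_(n, m)) (K : 'M[R]_(n, v)),
    [/\ C *m B = 1%:M, C *m K = 0 & B *m C + K *m V = 1%:M].
Proof.
move=> fC V_im; have uG := gram_unitmx fC.
(* This right inverse makes [Q] the orthogonal projection onto [ker C]. From [Q = V^T *m M] and
   symmetry, [M^T *m V = Q], so [K = Q *m M^T] gives [K *m V = Q]. *)
pose B := C^T *m invmx (C *m C^T); pose Q := 1%:M - B *m C.
have CB : C *m B = 1%:M by rewrite mulmxA mulmxV.
have CQ : C *m Q = 0 by rewrite mulmxBr mulmx1 mulmxA CB mul1mx subrr.
have Qsym : Q^T = Q.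
  by rewrite [Q^T]linearB /= trmx1 !trmx_mul trmx_inv trmx_mul trmxK mulmxA.
have [M QM] : exists M, Q = V^T *m M.
  by apply: mx_im_sub => j; apply: V_im; rewrite /mx_ker /= mulmx_col CQ col0.
exists B, (Q *m M^T); split=> //; first by rewrite mulmxA CQ mul0mx.
have -> : Q *m M^T *m V = Q.
  rewrite -mulmxA -[M^T *m V]trmxK trmx_mul trmxK -QM Qsym.
  by rewrite {1}/Q mulmxBl mul1mx -mulmxA CQ mulmx0 subr0.
by rewrite addrC subrK.
Qed.

Lemma congr_mx_supp (K : pzRingType) n p (F : 'M[K]_(p, n)) (M M' : 'M[K]_p)
    (A : set 'I_p) :
  (forall k, ~ A k -> row k F = 0) ->
  (forall k l, A k -> A l -> M k l = M' k l) ->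
  F^T *m M *m F = F^T *m M' *m F.
Proof.
move=> F0 MM; apply/matrixP => x y; rewrite !mxE; apply: eq_bigr => l _.
have [Al|/F0/rowP/(_ y)] := pselect (A l); last first.
  by rewrite !mxE => ->; rewrite !mulr0.
congr (_ * _); rewrite !mxE; apply: eq_bigr => k _.
have [Ak|/F0/rowP/(_ x)] := pselect (A k); last first.
  by rewrite !mxE => ->; rewrite !mul0r.
by rewrite MM.
Qed.

(** Since [L *m F i = 1], [P i] is the congruence by [F i] of [L^T *m P i *m L], of which only the
    entries at indices active in [i] matter. *)
Lemma congr_mx_glue (R : realType) (I : Type) n p (P : I -> 'M[R]_n)
    (F : I -> 'M[R]_(p, n)) (L : 'M[R]_(n, p)) (A : I -> set 'I_p) :
  (forall i, (P i)^T = P i) -> (forall i, L *m F i = 1%:M) ->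
  (forall i k, ~ A i k -> row k (F i) = 0) ->
  (forall i j k l, A i k -> A i l -> A j k -> A j l ->
     (L^T *m P i *m L) k l = (L^T *m P j *m L) k l) ->
  exists2 Phi : 'M[R]_p, Phi^T = Phi &
    forall i, P i = (F i)^T *m Phi *m F i.
Proof.
move=> Psym LF F0 Pcomp.
have /choice[phi phiE] (kl : 'I_p * 'I_p) : exists t, forall i,
    A i kl.1 -> A i kl.2 -> (L^T *m P i *m L) kl.1 kl.2 = t.
  have [[j [jk jl]]|no] := pselect (exists j, A j kl.1 /\ A j kl.2).
    by exists ((L^T *m P j *m L) kl.1 kl.2) => i ik il; exact: Pcomp.
  (* A pair active in no common cone is unconstrained. *)
  by exists 0 => i ik il; case: no; exists i.
(* The values [phi] are chosen entry by entry and may be asymmetric; averaging repairs this and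
   keeps active entries, as [L^T *m P i *m L] is symmetric. *)
exists (\matrix_(k, l) (2%:R^-1 * (phi (k, l) + phi (l, k)))).
  by apply/matrixP => k l; rewrite !mxE addrC.
move=> i; have -> : P i = (F i)^T *m (L^T *m P i *m L) *m F i.
  by rewrite !mulmxA -trmx_mul LF trmx1 mul1mx -mulmxA LF mulmx1.
apply: congr_mx_supp (F0 i) _ => k l Ak Al.
rewrite [RHS]mxE -(phiE (k, l) i) // -(phiE (l, k) i) //=.
have -> : (L^T *m P i *m L) l k = (L^T *m P i *m L) k l.
  have Msym : (L^T *m P i *m L)^T = L^T *m P i *m L.
    by rewrite !trmx_mul trmxK Psym mulmxA.
  by rewrite -[in LHS]Msym mxE.
by rewrite mulrDr [_^-1 * _]mulrC -splitr.
Qed.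

(* The span of a cone [K] is [K - K], and on three points [x], [y], [x + y] of
   the cone, polarization yields the vanishing of [qform D (x - y)]. *)
Lemma qform_cone_span (R : realType) m n q (D : 'M[R]_n) (C : 'M[R]_(m, n))
    (B : 'M[R]_(n, m)) (Z : 'M[R]_(m, q)) (S : set 'cV[R]_m) :
  D^T = D -> C *m B = 1%:M ->
  (forall w : 'cV_q, (forall k, 0 <= w k 0) -> S (Z *m w)) ->
  (forall x, S (C *m x) -> qform D x = 0) ->
  forall x, mx_im Z (C *m x) -> qform D x = 0.
Proof.
move=> Dsym CB SZ D0 x [w _ Zw].
pose wp : 'cV[R]_q := \col_k Num.max (w k 0) 0.
pose wm : 'cV[R]_q := \col_k Num.max (- w k 0) 0.
have wE : w + wm = wp.
  apply/colP => k; rewrite !mxE; case: (leP (w k 0) 0) => w0.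
    by rewrite max_l ?oppr_ge0 // subrr.
  by rewrite max_r ?oppr_le0 ?ltW // addr0.
have wp0 k : 0 <= wp k 0 by rewrite mxE le_max lexx orbT.
have wm0 k : 0 <= wm k 0 by rewrite mxE le_max lexx orbT.
(* [B] lifts the negative part to [y], so that [x + y] lies over the positive part. *)
pose y := B *m (Z *m wm).
have Cy : C *m y = Z *m wm by rewrite mulmxA CB mul1mx.
have Cxy : C *m (x + y) = Z *m wp by rewrite mulmxDr Cy -Zw -mulmxDr wE.
have y0 : qform D y = 0 by apply: D0; rewrite Cy; exact: SZ.
have xy0 : qform D (x + y) = 0 by apply: D0; rewrite Cxy; exact: SZ.
have xyy0 : qform D (x + y + y) = 0.
  apply: D0; rewrite mulmxDr Cxy Cy -mulmxDr; apply: SZ => k.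
  by rewrite mxE addr_ge0.
have /matrixP/(_ 0 0) := qform_polar0 Dsym xy0 y0 xyy0.
rewrite [(x + y)^T]linearD !mulmxDl [LHS]mxE [RHS]mxE.
rewrite -[X in _ + X]/(qform D y) y0 addr0 => xDy.
by have := qformD x y Dsym; rewrite xy0 y0 xDy mul0rn !addr0.
Qed.

(** * Continuity on a finite closed cover *)

Lemma coord_mulmx_continuous (R : realType) p n (A : 'M[R]_(p, n)) k :
  continuous (fun x : 'cV[R]_n => (A *m x) k 0).
Proof.
have -> : (fun x : 'cV[R]_n => (A *m x) k 0) =
    (fun x => \sum_(i < n) A k i * x i 0) by apply/funext => x; rewrite mxE.
apply: continuous_big => [|i _]; first exact: add_continuous.
move=> x; apply: continuousM; first exact: cst_continuous.
exact: coord_continuous.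
Qed.

Lemma qform_continuous (R : realType) n (D : 'M[R]_n) : continuous (qform D).
Proof.
have -> : qform D = (fun x => \sum_(i < n) x i 0 * (D *m x) i 0).
  apply/funext => x; rewrite /qform -mulmxA mxE.
  by apply: eq_bigr => i _; rewrite mxE.
apply: continuous_big => [|i _]; first exact: add_continuous.
move=> x; apply: continuousM; first exact: coord_continuous.
exact: coord_mulmx_continuous.
Qed.

Lemma closed_nneg_mulmx (R : realType) p n (A : 'M[R]_(p, n)) :
  closed [set x : 'cV[R]_n | forall k, 0 <= (A *m x) k 0].
Proof.
have -> : [set x : 'cV[R]_n | forall k, 0 <= (A *m x) k 0] =
    \bigcap_k ((fun x => (A *m x) k 0) @^-1` [set t | 0 <= t]).
  by apply/seteqP; split=> x xP k; [move=> _; exact: xP | exact: (xP k I)].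
apply: closed_bigI => k _; apply: preimage_closed; last exact: closed_ge.
by move=> x _; apply: coord_mulmx_continuous.
Qed.

Lemma within_bigcup_continuous (T U : topologicalType) (I : finType)
    (A : I -> set T) (f : T -> U) :
  (forall i, closed (A i)) -> (forall i, {within A i, continuous f}) ->
  {within \bigcup_i A i, continuous f}.
Proof.
move=> A_closed fA.
have -> : \bigcup_i A i = \big[setU/set0]_i A i.
  rewrite -bigcup_seq; congr bigcup.
  by apply/seteqP; split=> i //=; rewrite mem_index_enum.
(* Closedness joins the induction because pasting two pieces requires both to be closed. *)
have [] // : closed (\big[setU/set0]_i A i) /\
             {within \big[setU/set0]_i A i, continuous f}.
elim/big_ind : _ => [|B1 B2 [c1 f1] [c2 f2]|i _]; last by [].
  by split; [exact: closed0 | exact: continuous_subspace0].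
by split; [exact: closedU | exact: withinU_continuous].
Qed.

(** * The equivalences and the continuous piecewise quadratic function *)

Theorem theorem1 (R : realType) (m n N : nat)
    (m_gt0 : (0 < m)%N) (le_mn : (m <= n)%N) (N_gt0 : (0 < N)%N)
    (C : 'M[R]_(m, n)) (C_full : \rank C = m)
    (Zset : set 'cV[R]_m) (S : 'I_N -> set 'cV[R]_m)
    (S_part : simplicial_conic_partition Zset S)
    (S_face : forall i j,
       is_face (S i `&` S j) (S i) /\ is_face (S i `&` S j) (S j))
    (P : 'I_N -> 'M[R]_n) (P_sym : forall i, (P i)^T = P i)
    (r : nat) (Rbar : 'M[R]_(m, r)) (Rbar_rays : is_ray_matrix S Rbar)
    (E : 'I_N -> 'M[R]_(r, m))
    (E_extr : forall i, is_extraction_matrix (S i) Rbar (E i))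
    (q : 'I_N -> 'I_N -> nat) (Z : forall i j : 'I_N, 'M[R]_(m, q i j))
    (Z_shared : forall i j, is_shared_ray_matrix (S i) (S j) Rbar (Z i j))
    (h : 'I_N -> 'I_N -> nat) (H : forall i j : 'I_N, 'M[R]_(h i j, m))
    (H_perp : forall i j, is_perp (Z i j)^T (H i j)^T)
    (Cperp : 'M[R]_(n, n - m)) (C_perp : is_perp C Cperp)
    (v : nat) (V : 'M[R]_(v, n)) (V_im : mx_ker C `<=` mx_im V^T) :
  [<-> forall i j x, (S i `&` S j) (C *m x) -> qform (P i - P j) x = 0;
       forall i j x, mx_im (Z i j) (C *m x) -> qform (P i - P j) x = 0;
       forall i j, (W_mx le_mn C Cperp (Z i j))^T *m (P i - P j) *m
                   W_mx le_mn C Cperp (Z i j) = 0;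
       exists2 Phi : 'M[R]_(r + v), Phi^T = Phi &
         forall i, P i = (F_mx C Rbar (E i) V)^T *m Phi *m
                         F_mx C Rbar (E i) V;
       exists Gamma : forall i j : 'I_N, 'M[R]_(h i j, n),
         forall i j, P i - P j + (H i j *m C)^T *m Gamma i j
                     + (Gamma i j)^T *m (H i j *m C) = 0]
  /\
  ((forall i j x, (S i `&` S j) (C *m x) -> qform (P i - P j) x = 0) ->
   exists f : 'cV[R]_n -> R,
     (forall i x, S i (C *m x) -> f x = qform (P i) x) /\
     {within [set x | Zset (C *m x)], continuous f}).
Proof.
have fC : row_free C by rewrite /row_free C_full.
have [S_simpl _ _ _] := S_part.
have [_ S_rays _] := Rbar_rays.
have Dsym i j : (P i - P j)^T = P i - P j.
  by rewrite [LHS]linearB /= !P_sym.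
have meetP i j z : (S i `&` S j) z -> mx_im (Z i j) z.
  exact: (meet_sub_shared (S_simpl i) (S_simpl j) (S_rays i) (S_rays j)
            (E_extr i) (E_extr j) (Z_shared i j) (S_face i j).1).
have [B [K [CB CK BCKV]]] := right_inverse_ker fC V_im.
have s21 : (forall i j x, mx_im (Z i j) (C *m x) -> qform (P i - P j) x = 0) ->
    forall i j x, (S i `&` S j) (C *m x) -> qform (P i - P j) x = 0.
  by move=> s2 i j x /meetP; exact: s2.
have s12 : (forall i j x, (S i `&` S j) (C *m x) -> qform (P i - P j) x = 0) ->
    forall i j x, mx_im (Z i j) (C *m x) -> qform (P i - P j) x = 0.
  move=> s1 i j; apply: (qform_cone_span (Dsym i j) CB _ (s1 i j)).
  exact: (shared_sub_meet (S_simpl i) (S_simpl j) (S_rays i) (S_rays j)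
            (E_extr i) (E_extr j) (Z_shared i j)).
have s23 : (forall i j x, mx_im (Z i j) (C *m x) -> qform (P i - P j) x = 0) <->
    forall i j, (W_mx le_mn C Cperp (Z i j))^T *m (P i - P j) *m
                   W_mx le_mn C Cperp (Z i j) = 0.
  split=> [s2 i j|s3 i j x /(mx_im_W le_mn _ _ C_perp)[y _ <-]].
    apply: congr_mx_eq0 => // y; apply: s2; apply/(mx_im_W le_mn _ _ C_perp).
    by exists y.
  by rewrite qform_mul s3 qform0.
have s42 : (exists2 Phi : 'M[R]_(r + v), Phi^T = Phi &
         forall i, P i = (F_mx C Rbar (E i) V)^T *m Phi *m
                         F_mx C Rbar (E i) V) ->
    forall i j x, mx_im (Z i j) (C *m x) -> qform (P i - P j) x = 0.
  move=> [Phi _ PE] i j x Zx; rewrite qformB !PE -!qform_mul.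
  suff -> : F_mx C Rbar (E i) V *m x = F_mx C Rbar (E j) V *m x by rewrite subrr.
  rewrite !mul_col_mx -!(mulmxA _ C) ; congr col_mx.
  exact: (extraction_coord_eq (S_simpl i) (S_simpl j) (S_rays i) (S_rays j)
            (E_extr i) (E_extr j) (Z_shared i j) Zx).
have s52 : (exists Gamma : forall i j : 'I_N, 'M[R]_(h i j, n),
         forall i j, P i - P j + (H i j *m C)^T *m Gamma i j
                     + (Gamma i j)^T *m (H i j *m C) = 0) ->
    forall i j x, mx_im (Z i j) (C *m x) -> qform (P i - P j) x = 0.
  move=> [Gamma GE] i j x [w _ Zw].
  apply: (qform_decomp_ker (GE i j)).
  by rewrite -mulmxA -Zw mulmxA (perp_mulmx (H_perp i j)) mul0mx.
have s25 : (forall i j x, mx_im (Z i j) (C *m x) -> qform (P i - P j) x = 0) ->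
    exists Gamma : forall i j : 'I_N, 'M[R]_(h i j, n),
         forall i j, P i - P j + (H i j *m C)^T *m Gamma i j
                     + (Gamma i j)^T *m (H i j *m C) = 0.
  (* The size of the witness depends on [i] and [j], so it is extracted as a dependent pair. *)
  move=> s2; have G i j : {G : 'M[R]_(h i j, n) |
      P i - P j + (H i j *m C)^T *m G + G^T *m (H i j *m C) = 0}.
    apply: cid; apply: qform_ker_decomp => // [|x HCx].
      have [fH _] := H_perp i j; rewrite trmxK in fH.
      by rewrite /row_free mxrankMfree.
    by apply/s2/(perp_ker (H_perp i j)); rewrite mulmxA.
  by exists (fun i j => sval (G i j)) => i j; exact: svalP (G i j).
have s24 : (forall i j x, mx_im (Z i j) (C *m x) -> qform (P i - P j) x = 0) ->
    exists2 Phi : 'M[R]_(r + v), Phi^T = Phi &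
         forall i, P i = (F_mx C Rbar (E i) V)^T *m Phi *m
                         F_mx C Rbar (E i) V.
  (* [L *m F_i] reduces to [B *m C + K *m V = 1] for every [i]. [C] sends the columns of [L] to the
     rays, or to 0 for those of [K]. *)
  move=> s2; pose L := row_mx (B *m Rbar) K.
  (* Indices belonging to [V] satisfy this vacuously, hence are active in every cone. *)
  pose A i (k : 'I_(r + v)) := forall j, k = lshift v j -> S i (col j Rbar).
  have CL i j k : A i k -> A j k -> mx_im (Z i j) (C *m col k L).
    rewrite mulmx_col mul_mx_row CK mulmxA CB mul1mx.
    case: (split_ordP k) => l -> => [/(_ l erefl) il /(_ l erefl) jl|_ _].
      rewrite colKl.
      exact: (mx_im_shared (S_simpl i) (S_simpl j) (S_rays i) (S_rays j)
                (E_extr i) (E_extr j) (Z_shared i j)).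
    by rewrite colKr col0; exists 0 => //; rewrite mulmx0.
  apply: (congr_mx_glue P_sym (L := L) (A := A)) => [i|i k|i j k l ik il jk jl].
  - rewrite mul_row_col !mulmxA -(mulmxA B) -(mulmxA B _ (invmx _)) mulmxV.
      by rewrite mulmx1.
    by have [] := extraction_cone (S_simpl i) (S_rays i) (E_extr i).
  - case: (split_ordP k) => l ->; last first.
      by case=> j /eqP; rewrite eq_rlshift.
    move=> Al; rewrite rowKu -mulmxA row_mul (E_extr i).1 ?mul0mx // => Sl.
    by apply: Al => j /lshift_inj <-.
  (* The difference of entries is the bilinear form of [P i - P j] at two columns of [L] lying, with
     their sum, over [im (Z i j)]; polarization and (2) finish. *)
  apply/eqP; rewrite -subr_eq0.
  have -> : (L^T *m P i *m L) k l - (L^T *m P j *m L) k l =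
            (L^T *m (P i - P j) *m L) k l by rewrite mulmxBr mulmxBl !mxE.
  have [[wk _ Zk] [wl _ Zl]] := (CL i j k ik jk, CL i j l il jl).
  rewrite congr_mxE (qform_polar0 (Dsym i j)) ?mxE //; apply: s2.
  - by exists wk.
  - by exists wl.
  by exists (wk + wl); rewrite // !mulmxDr Zk Zl.
split.
  tfae.
  - exact: s12.
  - exact: s23.1.
  - by move=> /s23.2/s24.
  - by move=> /s42/s25.
  - by move=> /s52/s21.
move=> s1.
(* By (1) all cones containing [C *m x] give the same value. *)
have /choice[f fP] x : exists t, forall i, S i (C *m x) -> qform (P i) x = t.
  have [[j Sj]|no] := pselect (exists j, S j (C *m x)).
    exists (qform (P j) x) => i Si.
    by apply/eqP; rewrite -subr_eq0 -qformB s1.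
  by exists 0 => i Si; case: no; exists i.
exists f; split=> [i x /fP <-//|].
have -> : [set x | Zset (C *m x)] = \bigcup_i [set x | S i (C *m x)].
  have [_ -> _ _] := S_part.
  by apply/seteqP; split=> x [i _ Si]; exists i.
apply: within_bigcup_continuous => i.
  have [_ SE] := extraction_cone (S_simpl i) (S_rays i) (E_extr i).
  have -> : [set x | S i (C *m x)] =
      [set x | forall k, 0 <= (invmx (Rbar *m E i) *m C *m x) k 0].
    by apply/seteqP; split=> x /=; rewrite SE mulmxA.
  exact: closed_nneg_mulmx.
(* On each closed piece [f] coincides with a globally continuous quadratic form. *)
apply: (@subspace_eq_continuous _ _ _ (qform (P i))) => [x /set_mem/fP//|].
exact/continuous_subspaceT/qform_continuous.
Qed.
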